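(* Let $\lambda_{\min},\lambda_{\max}$ with $0<\lambda_{\min}\le\lambda_{\max}<\infty$ and positive weights $\omega=\{\omega_i\}_{i=0}^n$ be such that $$\lambda_{\min}\,|||v|||_\omega^2\le a(v,v)\le\lambda_{\max}\,|||v|||_\omega^2\qquad\text{for all } v\in V,$$ and put $\kappa:=\lambda_{\max}/\lambda_{\min}$. Let $0<\xi<2/\lambda_{\max}$, let $\{p_m\}_{m\ge0}$ be a fixed sequence of integers with $1\le p_m\le n+1$, and consider the iteration $$u^{(0)}=0,\qquad u^{(m+1)}=u^{(m)}+\sum_{i\in I_m}\xi\,\omega_i\,R_iT_i e_u^{(m)},\qquad e_u^{(m)}:=u-u^{(m)},\qquad m=0,1,\dots,$$ where $u\in V$ is the solution of the variational problem $a(u,v)=F(v)$ for all $v\in V$. (i) If each $I_m$ is a random subset of $\{0,1,\dots,n\}$ of size $p_m$ satisfying assumption (A), then $$\mathbb{E}\big(\|e_u^{(m+1)}\|^2\,\big|\,u^{(m)}\big)\le\left(1-\frac{\lambda_{\max}\xi(2-\lambda_{\max}\xi)\,p_m}{\kappa(n+1)}\right)\|e_u^{(m)}\|^2,\qquad m=0,1,\dots.$$ (ii) If in addition assumption (B) holds, then for any $u\in V$ the iteration converges in expectation (that is, $\mathbb{E}(\|e_u^{(m)}\|^2)\to0$ as $m\to\infty$), and $$\mathbb{E}\big(\|e_u^{(m)}\|^2\big)\le\prod_{s=0}^{m-1}\left(1-\frac{\lambda_{\max}\xi(2-\lambda_{\max}\xi)\,p_s}{\kappa(n+1)}\right)\|u\|^2,\qquad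 m=1,2,\dots.$$
   Context: Setting. $V$ is a separable real Hilbert space, $a(\cdot,\cdot)$ is a continuous, coercive, symmetric bilinear form on $V$, and $F$ is a bounded linear functional on $V$. $V$ is equipped with the scalar product $a(\cdot,\cdot)$ and norm $\|v\|=a(v,v)^{1/2}$. The solution $u\in V$ is the unique element with $a(u,v)=F(v)$ for all $v\in V$. Space splitting. $V_0,\dots,V_n$ are separable real Hilbert spaces, each equipped with a scalar product $a_i(\cdot,\cdot)$ spectrally equivalent to the original scalar product of $V_i$. $R_i:V_i\to V$ are bounded linear operators with $\mathrm{Ker}(R_i)=\{0\}$ and $\sum_{i=0}^nR_iV_i=V$. The bounded linear operators $T_i:V\to V_i$ are defined by $a_i(T_iv,v_i)=a(v,R_iv_i)$ for all $v_i\in V_i$, $v\in V$. Norm. For positive weights $\omega_i$, $$|||v|||_\omega^2:=\inf\Big\{\sum_{i=0}^n\omega_i a_i(v_i,v_i)\ :\ v_i\in V_i,\ v=\sum_{i=0}^n\omega_iR_iv_i\Big\}.$$ Assumption (A): $I_m$ is a uniformly at random chosen subset of size $p_m$ of $\{0,1,\dots,n\}$, i.e., $|I_m|=p_m$ and $\mathbb{P}(i\in I_m)=\mathbb{P}(i'\in I_m)$ for all $i,i'\in\{0,\dots,n\}$. Assumption (B): the choices of $I_m$ are independent for different $m$. Convention: $\mathbb{E}(\cdot\,|\,u^{(m)})$ denotes the expectation with respect to the random choice of $I_m$, for arbitrarily fixed $u^{(m)}$. *)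

(* Defs.v *)
From HB Require Import structures.
From mathcomp Require Import all_boot all_order all_algebra.
From mathcomp Require Import sesquilinear.
From mathcomp Require Import all_classical all_reals all_analysis.

Set Implicit Arguments.
Unset Strict Implicit.
Unset Printing Implicit Defensive.

Import Order.TTheory GRing.Theory Num.Theory.
Import numFieldNormedType.Exports.

Local Open Scope classical_set_scope.
Local Open Scope ring_scope.

(* Over a real field, {dot V for idfun} is the type of symmetric, positive
   definite bilinear forms. *)
HB.mixin Record isHilbert (K : realType) V & CompleteNormedModule K V := {
  scalar_product : {dot V for @idfun K};
  sqr_norm_scalar_product :
    forall v : V, `|v| ^+ 2 = scalar_product v v
}.

#[short(type="hilbertType")]
HB.structure Definition Hilbert (K : realType) :=
  { V of CompleteNormedModule K V & isHilbert K V }.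

Definition separable (T : topologicalType) : Prop :=
  exists2 D : set T, countable D & dense D.

Section Forms.
Variable K : realType.

Definition bounded_op (V W : normedModType K) (f : V -> W) : Prop :=
  exists M : K, forall v, `|f v| <= M * `|v|.

Definition continuous_form (V : normedModType K) (a : V -> V -> K) : Prop :=
  continuous (fun p : V * V => a p.1 p.2).

Definition coercive (V : normedModType K) (a : V -> V -> K) : Prop :=
  exists2 c : K, 0 < c & forall v, c * `|v| ^+ 2 <= a v v.

Definition spectrally_equivalent (V : normedModType K) (a b : V -> V -> K) :
    Prop :=
  exists c C : K, [/\ 0 < c, 0 < C &
    forall v, c * b v v <= a v v /\ a v v <= C * b v v].

Definition energy_norm (V : normedModType K) (a : V -> V -> K) (v : V) : K :=
  Num.sqrt (a v v).

End Forms.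

Section SpaceSplitting.
Context {K : realType} {V : hilbertType K} {n : nat}.
Context {V_ : 'I_n.+1 -> hilbertType K}.
Variables (a_ : forall i, V_ i -> V_ i -> K) (R_ : forall i, V_ i -> V).
Variable omega : 'I_n.+1 -> K.

(* The square |||v|||_omega ^ 2. *)
Definition splitting_norm2 (v : V) : K :=
  inf [set \sum_i omega i * a_ (w i) (w i) | w in
        [set w : forall i, V_ i | v = \sum_i omega i *: R_ (w i)]].

Variables (T_ : forall i, V -> V_ i) (u : V) (xi : K).

(* u^(m) |-> u^(m+1) when the chosen index set is J. *)
Definition schwarz_step (J : {set 'I_n.+1}) (v : V) : V :=
  v + \sum_(i in J) (xi * omega i) *: R_ (T_ i (u - v)).

Fixpoint schwarz_iter (J : nat -> {set 'I_n.+1}) (m : nat) : V :=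
  if m is m'.+1 then schwarz_step (J m') (schwarz_iter J m') else 0.

End SpaceSplitting.

HB.instance Definition _ (T : finType) := isPointed.Build {set T} (finset.set0).
HB.instance Definition _ (T : finType) :=
  @isMeasurable.Build default_measure_display {set T}
    discrete_measurable discrete_measurable0
    discrete_measurableC discrete_measurableU.

Section RandomSubsets.
Context {d : measure_display} {Omega : measurableType d} {K : realType}.
Variable P : probability Omega K.

(* Only the marginal inclusion probabilities are required to be equal; the law
   of I need not be uniform on the subsets of size p. *)
Definition random_subset (T : finType) (I : {RV P >-> {set T}}) (p : nat) :
    Prop :=
  (forall w, #|I w| = p) /\
  (forall i i' : T, P [set w | i \in I w] = P [set w | i' \in I w]).

Definition mutually_independent d' (T : measurableType d')
    (X : nat -> {RV P >-> T}) : Prop :=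
  forall (s : seq nat) (E : nat -> set T), uniq s ->
    (forall m, measurable (E m)) ->
    P (\bigcap_(m in [set` s]) (X m @^-1` E m)) =
      (\prod_(m <- s) P (X m @^-1` E m))%E.

End RandomSubsets.

Arguments random_subset {d Omega K} P {T} I p.
Arguments mutually_independent {d Omega K} P {d' T} X.

(* Main.v *)
(* With e = u - v and t_i = a_i (T_i e, T_i e) = a (e, R_i T_i e), one step with
   index set J lowers a (e, e) by at least
   xi (2 - lmax xi) \sum_(i in J) omega_i t_i, by the upper stability bound
   applied to the correction itself. Averaging over J replaces the sum by
   p / (n + 1) times the sum over all i, which is at least lmin a (e, e) by the
   lower stability bound; this is (i). Everything takes finitely many values, so
   (ii) follows from (i) by conditioning on the finite history of the index
   sets, which is independent of the next one. *)

Require Import Defs.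
From mathcomp Require Import all_boot all_order all_algebra.
From mathcomp Require Import sesquilinear.
From mathcomp Require Import all_classical all_reals all_analysis.
From mathcomp Require Import measurable_realfun ring lra.

Import Order.TTheory GRing.Theory Num.Theory.
Import numFieldNormedType.Exports.

Local Open Scope classical_set_scope.
Local Open Scope ring_scope.

(** * Algebra of symmetric forms and Young's inequality *)

Section SymmetricForm.
Context {K : realType} {V : lmodType K} (b : {symmetric V}).

Lemma formC (v w : V) : b v w = b w v.
Proof. by rewrite hermC expr0 mul1r. Qed.

Lemma formZl (c : K) (v w : V) : b (c *: v) w = c * b v w.
Proof. exact: linearZl_LR. Qed.

Lemma formZr (c : K) (v w : V) : b v (c *: w) = c * b v w.
Proof. exact: linearZr_LR. Qed.

Lemma formBB (c : K) (v w : V) :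
  b (v - c *: w) (v - c *: w) = b v v - 2 * c * b v w + c ^+ 2 * b w w.
Proof. by rewrite linearBl !linearBr /= !formZl !formZr (formC w v); ring. Qed.

Lemma form_sumZr (I : Type) (r : seq I) (Q : pred I) (c : I -> K) (v : V)
    (w : I -> V) :
  b v (\sum_(i <- r | Q i) c i *: w i) = \sum_(i <- r | Q i) c i * b v (w i).
Proof. by rewrite linear_sumr; apply: eq_bigr => i _; exact: formZr. Qed.

End SymmetricForm.

Lemma dot_ge0 (K : realType) (V : lmodType K) (b : {dot V for @idfun K})
  (v : V) : 0 <= b v v.
Proof.
have [->|v0] := eqVneq v 0; first by rewrite linear0l.
exact/ltW/neq0_dnorm_gt0.
Qed.

(** Nonnegativity of [b] at [v - s *: w]. The free parameter [s] does the work of Cauchy-Schwarz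
    without square roots. *)
Lemma dot_young (K : realType) (V : lmodType K) (b : {dot V for @idfun K})
  (s : K) (v w : V) : 2 * s * b v w <= b v v + s ^+ 2 * b w w.
Proof.
have := dot_ge0 K V b (v - s *: w).
rewrite formBB; lra.
Qed.

(** * The splitting norm and the energy decay for a fixed index set *)

Section SplittingNorm.
Context {K : realType} {V : hilbertType K} {n : nat}.
Context {V_ : 'I_n.+1 -> hilbertType K}.
Context {a_ : forall i, {dot (V_ i) for @idfun K}}.
Context {R_ : forall i, {linear V_ i -> V}} {omega : 'I_n.+1 -> K}.
Context (omega_gt0 : forall i, 0 < omega i).

Lemma splitting_norm2_le (w : forall i, V_ i) :
  splitting_norm2 a_ R_ omega (\sum_i omega i *: R_ i (w i)) <=
  \sum_i omega i * a_ i (w i) (w i).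
Proof.
apply: ge_inf; last by exists w.
exists 0 => _ [x _ <-]; apply: sumr_ge0 => i _.
by rewrite mulr_ge0 ?dot_ge0// ltW.
Qed.

(** The infimum of an empty set would be a default value, so a decomposition must be exhibited:
    [R_sum] gives one after division by the weights. *)
Lemma le_splitting_norm2
    (R_sum : forall v : V, exists w : forall i, V_ i, v = \sum_i R_ i (w i))
    (v : V) (x : K) :
  (forall w : forall i, V_ i, v = \sum_i omega i *: R_ i (w i) ->
    x <= \sum_i omega i * a_ i (w i) (w i)) ->
  x <= splitting_norm2 a_ R_ omega v.
Proof.
move=> xle; apply: lb_le_inf => [|_ [w /= vw <-]]; last exact: xle.
have [w vw] := R_sum v.
pose w' i := (omega i)^-1 *: w i.
exists (\sum_i omega i * a_ i (w' i) (w' i)), w' => //=.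
rewrite vw; apply: eq_bigr => i _.
by rewrite /w' linearZ_LR scalerA divff ?scale1r// gt_eqF.
Qed.

Context (a : {symmetric V}).
Context (T_ : forall i, {linear V -> V_ i}).
Context (T_def : forall i (v : V) (w : V_ i), a_ i (T_ i v) w = a v (R_ i w)).

(** By [T_def] this is [a v (\sum_(i in J) omega i *: R_ i (T_ i v))], the quadratic form of the
    additive Schwarz operator restricted to [J]. *)
Definition schwarz_energy (J : {set 'I_n.+1}) (v : V) : K :=
  \sum_(i in J) omega i * a_ i (T_ i v) (T_ i v).

Lemma schwarz_energy_lower (lmin : K) (v : V) : 0 < lmin ->
  (forall v : V, exists w : forall i, V_ i, v = \sum_i R_ i (w i)) ->
  lmin * splitting_norm2 a_ R_ omega v <= a v v ->
  lmin * a v v <= schwarz_energy finset.setT v.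
Proof.
move=> lmin0 R_sum lower.
pose S := schwarz_energy finset.setT v.
(* Optimizing Young's inequality over the decompositions of v; the parameter
   lmin is the one for which the quadratic term is absorbed by [lower]. *)
have key : (2 * lmin * a v v - S) / lmin ^+ 2 <= splitting_norm2 a_ R_ omega v.
  apply: le_splitting_norm2 => // w vw.
  rewrite ler_pdivrMr ?exprn_gt0// lerBlDr.
  have -> : a v v = \sum_i omega i * a_ i (T_ i v) (w i).
    rewrite {2}vw form_sumZr; apply: eq_bigr => i _.
    by rewrite T_def.
  have -> : S = \sum_i omega i * a_ i (T_ i v) (T_ i v).
    by apply: eq_bigl => i; rewrite finset.in_setT.
  rewrite addrC mulr_sumr mulr_suml.
  rewrite -big_split /=; apply: ler_sum => i _.
  have := dot_young _ _ (a_ i) lmin (T_ i v) (w i).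
  have := omega_gt0 i; nra.
(* [lower] times [lmin] bounds [lmin ^+ 2] times the splitting norm by [lmin * a v v], which absorbs
   half of [2 * lmin * a v v]. *)
rewrite -/S; move: key; rewrite ler_pdivrMr ?exprn_gt0// expr2 => key.
have := ler_wpM2l (ltW lmin0) lower; nra.
Qed.

Lemma energy_schwarz_step (lmax xi : K) (u v : V) (J : {set 'I_n.+1}) :
  0 <= lmax ->
  (forall v : V, a v v <= lmax * splitting_norm2 a_ R_ omega v) ->
  let e := u - schwarz_step R_ omega T_ u xi J v in
  a e e <= a (u - v) (u - v)
           - xi * (2 - lmax * xi) * schwarz_energy J (u - v).
Proof.
move=> lmax0 upper; set e := u - _; rewrite /=.
pose x := \sum_(i in J) omega i *: R_ i (T_ i (u - v)).
have -> : e = (u - v) - xi *: x.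
  rewrite /e /schwarz_step opprD addrA scaler_sumr; congr (_ - _).
  by apply: eq_bigr => i _; rewrite scalerA.
have ax : a (u - v) x = schwarz_energy J (u - v).
  rewrite form_sumZr; apply: eq_bigr => i _.
  by rewrite T_def.
have xx : a x x <= lmax * schwarz_energy J (u - v).
  apply: (le_trans (upper x)); apply: ler_wpM2l => //.
  (* Extending the local corrections by zero outside [J] makes them a decomposition of [x], whose
     cost is [schwarz_energy J (u - v)]. *)
  pose w i : V_ i := if i \in J then T_ i (u - v) else 0.
  have -> : x = \sum_i omega i *: R_ i (w i).
    rewrite /x big_mkcond; apply: eq_bigr => i _.
    by rewrite /w; case: ifP => // _; rewrite linear0 scaler0.
  apply: (le_trans (splitting_norm2_le w)).
  rewrite /schwarz_energy [leRHS]big_mkcond; apply: ler_sum => i _.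
  by rewrite /w; case: ifP => // _; rewrite linear0l mulr0.
rewrite formBB ax.
have := ler_wpM2l (sqr_ge0 xi) xx; nra.
Qed.

End SplittingNorm.

(** * Expectations of finite-valued variables and means over random subsets *)

Section FiniteValued.
Context {d : measure_display} {Omega : measurableType d} {K : realType}.
Context (P : probability Omega K).

(** The integrand is a finite combination of indicators of the fibres of [X]; nonnegativity lets sum
    and integral be exchanged. *)
Lemma expectation_finite_valued (T : finType) (X : Omega -> T) (f : T -> K) :
  (forall x, measurable (X @^-1` [set x])) -> (forall x, 0 <= f x) ->
  'E_P[fun w => f (X w)]%E = (\sum_x f x * fine (P (X @^-1` [set x])))%:E.
Proof.
move=> mX f0; rewrite unlock.
transitivity (\int[P]_w \sum_x ((f x)%:E * (\1_(X @^-1` [set x]) w)%:E))%E.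
  apply: eq_integral => w _; rewrite (bigD1 (X w))//= big1 => [|x xX].
    by rewrite indicE mem_set// mule1 adde0.
  rewrite indicE memNset ?mule0// => Xw; move: xX.
  by rewrite -Xw eqxx.
rewrite ge0_integral_sum// => [|x|x w _].
- rewrite -sumEFin; apply: eq_bigr => x _.
  rewrite ge0_integralZl//.
  + by rewrite integral_indic// setIT EFinM fineK// fin_num_measure.
  + exact/measurable_EFinP/measurable_indic.
  + by rewrite lee_fin.
- apply: emeasurable_funM => //.
  exact/measurable_EFinP/measurable_indic.
- by rewrite mule_ge0// lee_fin.
Qed.

(** Double counting: the inclusion probabilities of all elements add up to the expected cardinality
    [k], and they are all equal. *)
Lemma random_subset_inclusion (T : finType) (I : {RV P >-> {set T}}) (k : nat)
    (i : T) : random_subset P I k ->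
  \sum_(J : {set T} | i \in J) fine (P (I @^-1` [set J])) = k%:R / #|T|%:R.
Proof.
move=> [Ik Iunif].
have mI J : measurable (I @^-1` [set J]).
  exact: measurable_funPTI.
have inclE j : (\sum_(J : {set T} | j \in J) fine (P (I @^-1` [set J])))%:E =
    P [set w | j \in I w].
  transitivity 'E_P[fun w => ((j \in I w)%:R : K)]%E.
    rewrite (expectation_finite_valued _ _ (fun J : {set T} => (j \in J)%:R))//.
    rewrite big_mkcond; congr EFin; apply: eq_bigr => J _.
    by case: ifP; rewrite ?mul1r ?mul0r.
  have mj : measurable [set w | j \in I w].
    exact: (measurable_funPTI I (Y := [set J : {set T} | j \in J])).
  rewrite -(expectation_indic P mj); congr expectation.
  apply/funext => w; rewrite indicE; case: (boolP (j \in I w)) => jw.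
    by rewrite mem_set.
  by rewrite memNset //=; exact/negP.
have T0 : #|T|%:R != 0 :> K.
  by rewrite pnatr_eq0 -lt0n; apply/card_gt0P; exists i.
apply: (canRL (mulfK T0)); apply: EFin_inj.
rewrite mulr_natr -sumr_const.
transitivity (\sum_(j in T) \sum_(J : {set T} | j \in J)
    fine (P (I @^-1` [set J])))%:E.
  by congr EFin; apply: eq_bigr => j _; apply: EFin_inj; rewrite !inclE (Iunif i j).
rewrite (exchange_big_dep xpredT)//=.
transitivity 'E_P[fun w => (#|I w|%:R : K)]%E.
  rewrite (expectation_finite_valued _ _ (fun J : {set T} => #|J|%:R))//.
  by congr EFin; apply: eq_bigr => J _; rewrite sumr_const mulr_natl.
rewrite -(expectation_cst P k%:R); congr expectation.
by apply/funext => w; rewrite Ik.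
Qed.

Lemma random_subset_mean (T : finType) (I : {RV P >-> {set T}}) (k : nat)
    (x : T -> K) : random_subset P I k ->
  \sum_(J : {set T}) (\sum_(i in J) x i) * fine (P (I @^-1` [set J])) =
  k%:R / #|T|%:R * \sum_i x i.
Proof.
move=> Ik; under eq_bigr do rewrite mulr_suml.
rewrite (exchange_big_dep xpredT)//= mulr_sumr; apply: eq_bigr => i _.
by rewrite -mulr_sumr (random_subset_inclusion _ _ _ _ Ik) mulrC.
Qed.

Lemma sum_law_eq1 (T : finType) (X : Omega -> T) :
  (forall x, measurable (X @^-1` [set x])) ->
  \sum_x fine (P (X @^-1` [set x])) = 1.
Proof.
move=> mX; apply: EFin_inj; rewrite -(expectation_cst P 1).
rewrite (expectation_finite_valued _ _ (fun=> 1) mX)//.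
by under [in RHS]eq_bigr do rewrite mul1r.
Qed.

(** * Finite histories of the index sets and conditioning on them *)

Context {T : finType} (I : nat -> {RV P >-> {set T}}).

(** The past as a variable in a finite type, so that conditioning on it reduces to finite sums. *)
Definition history (m : nat) (w : Omega) : {ffun 'I_m -> {set T}} :=
  [ffun k : 'I_m => I k w].

(* Total extension of a finite history, set0 being a junk value beyond m. *)
Definition history_ext (m : nat) (h : {ffun 'I_m -> {set T}}) (k : nat) :
    {set T} :=
  oapp h finset.set0 (insub k).

Lemma history_extE m w k : (k < m)%N -> history_ext m (history m w) k = I k w.
Proof. by move=> km; rewrite /history_ext insubT /= ffunE. Qed.

Lemma history_preimage m h :
  history m @^-1` [set h] =
  \bigcap_(k in [set` iota 0 m]) (I k @^-1` [set history_ext m h k]).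
Proof.
apply/seteqP; split => w /=.
  by move=> <- k /=; rewrite mem_iota add0n => /andP[_ km]; rewrite history_extE.
move=> wh; apply/ffunP => k; rewrite ffunE.
have := wh k; rewrite /= mem_iota /= add0n ltn_ord => /(_ isT) ->.
by rewrite /history_ext valK.
Qed.

Lemma measurable_history m h : measurable (history m @^-1` [set h]).
Proof.
rewrite history_preimage; apply: fin_bigcap_measurable => // k _.
exact: measurable_funPTI.
Qed.

(** Mutual independence is used twice: at the times [m :: iota 0 m] to split the joint event into
    factors, and at [iota 0 m] to recombine the past factors into the law of the history. *)
Lemma history_independent m h J : mutually_independent P I ->
  P ((fun w => (history m w, I m w)) @^-1` [set (h, J)]) =
  (P (history m @^-1` [set h]) * P (I m @^-1` [set J]))%E.
Proof.
move=> indep; pose E k := if k == m then [set J] else [set history_ext m h k].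
have Emeas k : measurable (E k) by [].
have mE : m \notin iota 0 m by rewrite mem_iota ltnn andbF.
have EE k : k \in iota 0 m -> E k = [set history_ext m h k].
  by move=> km; rewrite /E ifN//; apply: contraNneq mE => kE; rewrite -{1}kE.
have := indep (m :: iota 0 m) E _ Emeas.
rewrite /= iota_uniq mE => /(_ isT).
rewrite big_cons {2}/E eqxx muleC.
rewrite (eq_big_seq (fun k => P (I k @^-1` [set history_ext m h k]))); last first.
  by move=> k km; rewrite EE.
rewrite -(indep _ (fun k => [set history_ext m h k])) ?iota_uniq//.
rewrite -history_preimage => <-; congr (P _).
apply/seteqP; split => w.
  case=> hw Jw k; rewrite /= inE => /orP[/eqP->|km]; first by rewrite /E eqxx.
  rewrite EE//; have : (history m @^-1` [set h]) w by [].
  by rewrite history_preimage; apply.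
move=> wE /=; congr pair; last by have := wE m; rewrite /= mem_head /E eqxx; apply.
have : (history m @^-1` [set h]) w; last by [].
rewrite history_preimage => k /= km.
by have := wE k; rewrite /= inE km orbT EE//; apply.
Qed.

(** This plays the role of the tower property. The joint law of past and present factors, so for
    each fixed [h] the sum over [J] is the expectation bounded by hypothesis. *)
Lemma expectation_history_step m (c : K)
    (g : {ffun 'I_m -> {set T}} -> {set T} -> K)
    (f : {ffun 'I_m -> {set T}} -> K) :
  mutually_independent P I ->
  (forall h J, 0 <= g h J) -> (forall h, 0 <= f h) ->
  (forall h, 'E_P[fun w => g h (I m w)] <= (c * f h)%:E)%E ->
  ('E_P[fun w => g (history m w) (I m w)] <=
   c%:E * 'E_P[fun w => f (history m w)])%E.
Proof.
move=> indep g0 f0 gf.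
have mI J : measurable (I m @^-1` [set J]) by exact: measurable_funPTI.
have mH := measurable_history m.
have mHI hJ : measurable ((fun w => (history m w, I m w)) @^-1` [set hJ]).
  case: hJ => h J; suff -> : (fun w => (history m w, I m w)) @^-1` [set (h, J)] =
      history m @^-1` [set h] `&` I m @^-1` [set J] by exact: measurableI.
  by apply/seteqP; split => w /= [-> ->].
rewrite (expectation_finite_valued _ _ (fun hJ => g hJ.1 hJ.2) mHI)//.
rewrite (expectation_finite_valued _ _ _ mH)// -EFinM lee_fin mulr_sumr.
pose F h J :=
  g h J * fine (P ((fun w => (history m w, I m w)) @^-1` [set (h, J)])).
rewrite (eq_bigr (fun hJ => F hJ.1 hJ.2)); last by case.
rewrite -(pair_bigA _ F)/= /F.
apply: ler_sum => h _.
under eq_bigr do rewrite history_independent// fineM ?fin_num_measure// mulrCA.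
rewrite -mulr_sumr mulrC mulrA ler_wpM2r ?fine_ge0//.
by have := gf h; rewrite (expectation_finite_valued _ _ _ mI).
Qed.

End FiniteValued.

(** Makes the iterate a function of the finite history, insensitive to the junk values of
    [history_ext]. *)
Lemma eq_schwarz_iter (K : realType) (V : hilbertType K) (n : nat)
    (V_ : 'I_n.+1 -> hilbertType K) (R_ : forall i, V_ i -> V)
    (omega : 'I_n.+1 -> K) (T_ : forall i, V -> V_ i) (u : V) (xi : K)
    (J J' : nat -> {set 'I_n.+1}) (m : nat) :
  (forall k, (k < m)%N -> J k = J' k) ->
  schwarz_iter R_ omega T_ u xi J m = schwarz_iter R_ omega T_ u xi J' m.
Proof.
elim: m => //= m ih JJ'; rewrite JJ'// ih// => k km.
by rewrite JJ'// (ltn_trans km).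
Qed.

(** * One-step decay, product bound and convergence *)

Theorem theorem1 (K : realType)
  (* variational problem *)
  (V : hilbertType K) (Vsep : separable V)
  (a : {symmetric V}) (acont : continuous_form a) (acoer : coercive a)
  (F : {linear V -> K^o}) (Fbnd : bounded_op F)
  (u : V) (usol : forall v, a u v = F v)
  (* space splitting *)
  (n : nat) (V_ : 'I_n.+1 -> hilbertType K) (V_sep : forall i, separable (V_ i))
  (a_ : forall i, {dot (V_ i) for @idfun K})
  (a_equiv : forall i,
     spectrally_equivalent (a_ i) (@scalar_product K (V_ i)))
  (R_ : forall i, {linear V_ i -> V}) (R_bnd : forall i, bounded_op (R_ i))
  (R_ker : forall i (w : V_ i), R_ i w = 0 -> w = 0)
  (R_sum : forall v : V, exists w : forall i, V_ i, v = \sum_i R_ i (w i))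
  (T_ : forall i, {linear V -> V_ i}) (T_bnd : forall i, bounded_op (T_ i))
  (T_def : forall i (v : V) (w : V_ i), a_ i (T_ i v) w = a v (R_ i w))
  (* stability of the splitting *)
  (lmin lmax : K) (lmin_gt0 : 0 < lmin) (lminmax : lmin <= lmax)
  (omega : 'I_n.+1 -> K) (omega_gt0 : forall i, 0 < omega i)
  (stable : forall v : V,
     lmin * splitting_norm2 a_ R_ omega v <= a v v /\
     a v v <= lmax * splitting_norm2 a_ R_ omega v)
  (* parameters of the iteration *)
  (xi : K) (xi_gt0 : 0 < xi) (xi_lt : xi < 2 / lmax)
  (p : nat -> nat) (p_range : forall m, (1 <= p m <= n.+1)%N)
  (* random index sets *)
  (d : measure_display) (Omega : measurableType d) (P : probability Omega K)
  (I : nat -> {RV P >-> {set 'I_n.+1}}) :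
  let kappa := lmax / lmin in
  let rho m :=
    1 - (lmax * xi * (2 - lmax * xi) * (p m)%:R) / (kappa * n.+1%:R) in
  let step := schwarz_step R_ omega T_ u xi in
  let um m := fun w : Omega => schwarz_iter R_ omega T_ u xi (I ^~ w) m in
  (forall m, random_subset P (I m) (p m)) ->
  (forall (m : nat) (v : V),
     ('E_P[fun w => (energy_norm a (u - step (I m w) v) ^+ 2)%R]
        <= (rho m * energy_norm a (u - v) ^+ 2)%R%:E)%E)
  /\
  (mutually_independent P I ->
     'E_P[fun w => (energy_norm a (u - um m w) ^+ 2)%R]%E @[m --> \oo] --> 0%E
     /\
     forall m, (1 <= m)%N ->
       ('E_P[fun w => (energy_norm a (u - um m w) ^+ 2)%R]
          <= ((\prod_(0 <= s < m) rho s) * energy_norm a u ^+ 2)%R%:E)%E).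
Proof.
move=> kappa rho step um Irand.
have lmax_gt0 : 0 < lmax by exact: lt_le_trans lminmax.
have xilmax : lmax * xi < 2 by rewrite mulrC -ltr_pdivlMr.
have n0 : (n.+1%:R : K) != 0 by rewrite pnatr_eq0.
have a_ge0 v : 0 <= a v v.
  have [c c0 /(_ v)] := acoer; apply: le_trans.
  by rewrite mulr_ge0 ?exprn_ge0// ltW.
have energyE v : energy_norm a v ^+ 2 = a v v by rewrite sqr_sqrtr.
(* Since [lmax / kappa = lmin], each factor is [1 - delta * p m]; as [p m] is at least 1,
   [1 - delta] is a uniform rate. *)
pose delta := lmin * xi * (2 - lmax * xi) / n.+1%:R.
have delta_gt0 : 0 < delta by rewrite divr_gt0 ?mulr_gt0 ?subr_gt0.
have rhoE m : rho m = 1 - delta * (p m)%:R.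
  rewrite /rho /delta /kappa; congr (1 - _); field.
  by rewrite nat1r n0 !gt_eqF.
have rho_ge0 m : 0 <= rho m.
  rewrite rhoE subr_ge0 /delta mulrAC ler_pdivrMr ?ltr0n// mul1r.
  have /andP[_ pn] := p_range m.
  have pnR : ((p m)%:R : K) <= n.+1%:R by rewrite ler_nat.
  (* [lmin <= lmax], and [lmax * xi * (2 - lmax * xi)] is 1 minus the square of [1 - lmax * xi]. *)
  have le1 : lmin * xi * (2 - lmax * xi) <= 1.
    have := ler_wpM2r (ltW xi_gt0) lminmax.
    have := sqr_ge0 (1 - lmax * xi); nra.
  have := ler_wpM2r (ler0n K (p m)) le1; lra.
have rho_le m : rho m <= 1 - delta.
  have /andP[p1 _] := p_range m.
  by rewrite rhoE lerD2l lerN2 ler_pMr// ler1n.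
have step_decay m v : ('E_P[fun w => (energy_norm a (u - step (I m w) v) ^+ 2)%R]
    <= (rho m * energy_norm a (u - v) ^+ 2)%R%:E)%E.
  have mI J : measurable (I m @^-1` [set J]) by exact: measurable_funPTI.
  rewrite (expectation_finite_valued P _ _
    (fun J => energy_norm a (u - step J v) ^+ 2) mI); last first.
    by move=> J; rewrite energyE.
  rewrite lee_fin energyE.
  pose c := xi * (2 - lmax * xi); pose e := u - v.
  have c_ge0 : 0 <= c by apply: mulr_ge0; rewrite ?subr_ge0; exact: ltW.
  apply: (@le_trans _ _ (\sum_J (a e e - c * schwarz_energy T_ J e) *
      fine (P (I m @^-1` [set J])))).
    apply: ler_sum => J _; rewrite ler_wpM2r ?fine_ge0// energyE.
    apply: (energy_schwarz_step omega_gt0 a T_ T_def) => //; first exact: ltW.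
    by move=> w; exact: (stable w).2.
  under eq_bigr do rewrite mulrBl -mulrA.
  rewrite sumrB -!mulr_sumr sum_law_eq1// mulr1.
  rewrite (random_subset_mean _ _ _ _ _ (Irand m)) card_ord.
  have := schwarz_energy_lower omega_gt0 a T_ T_def _ _ lmin_gt0 R_sum (stable e).1.
  rewrite -/e rhoE /schwarz_energy; under eq_bigl do rewrite finset.in_setT.
  (* The scaling [c * (p m / (n + 1))] is the coefficient of the full Schwarz energy in the mean;
     with [lmin] it gives [delta * p m]. *)
  move=> /(ler_wpM2l (mulr_ge0 c_ge0 (divr_ge0 (ler0n K (p m)) (ler0n K n.+1)))).
  rewrite /delta /c; move: (n.+1%:R^-1) => q; move: (\sum_i _) => S; lra.
split=> // indep.
pose E m := 'E_P[fun w => (energy_norm a (u - um m w) ^+ 2)%R]%E.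
have E_step m : (E m.+1 <= (rho m)%:E * E m)%E.
  pose U (h : {ffun 'I_m -> {set 'I_n.+1}}) :=
    schwarz_iter R_ omega T_ u xi (history_ext m h) m.
  have UE w : um m w = U (history P I m w).
    by apply: eq_schwarz_iter => k km; rewrite history_extE.
  have -> : E m.+1 = 'E_P[fun w => (energy_norm a
      (u - step (I m w) (U (history P I m w))) ^+ 2)%R]%E.
    by congr expectation; apply/funext => w; rewrite -UE.
  have -> : E m = 'E_P[fun w => (energy_norm a
      (u - U (history P I m w)) ^+ 2)%R]%E.
    by congr expectation; apply/funext => w; rewrite -UE.
  (* For a fixed history the iterate [U h] is deterministic, so [step_decay] supplies the
     conditional bound. *)
  apply: (expectation_history_step P I m (rho m)
    (fun h J => energy_norm a (u - step J (U h)) ^+ 2)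
    (fun h => energy_norm a (u - U h) ^+ 2)) => //.
  - by move=> h J; rewrite energyE.
  - by move=> h; rewrite energyE.
have E_le m : (E m <= ((\prod_(0 <= s < m) rho s) * energy_norm a u ^+ 2)%:E)%E.
  elim: m => [|m ih].
    by rewrite /E /um /= subr0 big_geq// mul1r expectation_cst.
  apply: (le_trans (E_step m)).
  rewrite big_nat_recr//= [_ * rho m]mulrC -mulrA EFinM.
  by rewrite lee_wpmul2l// lee_fin.
split=> [|m _]; last exact: E_le.
have E_ge0 m : (0 <= E m)%E.
  by apply: expectation_ge0 => w; rewrite energyE.
have prod_le m : \prod_(0 <= s < m) rho s <= (1 - delta) ^+ m.
  rewrite big_mkord -[m in leRHS]card_ord -prodr_const.
  by apply: ler_prod => k _; rewrite rho_ge0 rho_le.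
have r_lt1 : `|1 - delta| < 1.
  rewrite ger0_norm ?ltrBlDr ?ltrDl//.
  exact: le_trans (rho_ge0 0) (rho_le 0).
(* The expected squared errors lie between 0 and a geometric sequence of ratio [1 - delta]. *)
apply: (@squeeze_cvge _ _ _ _ (cst 0%E) _
  (fun m => (geometric (energy_norm a u ^+ 2) (1 - delta) m)%:E)).
- apply: nearW => m; rewrite E_ge0/=; apply: (le_trans (E_le m)).
  by rewrite lee_fin mulrC ler_wpM2l// energyE.
- exact: cvg_cst.
- by apply: cvg_EFin; [exact: nearW|exact: cvg_geometric].
Qed.
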